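(* Let $p$ and $q$ be two real numbers such that the quadratic equation $x^2-px+q=0$ has distinct real solutions $\alpha$ and $\beta$ with $0<|\beta|<|\alpha|<1$. Let $\varphi\colon \mathbb{R}\to D^+$ be a mapping (write $\varphi_x$ for $\varphi(x)$) such that $$\lim_{x\to-\infty}\varphi_x(t)=1 \quad\text{for all } t>0$$ and $$\varphi_x\ge \varphi_{x+1}\quad\text{for all } x\in\mathbb{R}.$$ Let $(X,\mu,T_M)$ be a complete random normed space, where $T_M(a,b)=\min(a,b)$. If a mapping $f\colon\mathbb{R}\to X$ satisfies $$\mu_{f(x)-pf(x-1)+qf(x-2)}\ge \varphi_x\quad\text{for all } x\in\mathbb{R},$$ then there exists a mapping $F\colon\mathbb{R}\to X$ satisfying $$F(x)=pF(x-1)-qF(x-2)\quad\text{for all } x\in\mathbb{R}$$ and $$\mu_{f(x)-F(x)}(t)\ge \varphi_x(\gamma t)\quad\text{for all } x\in\mathbb{R}\text{ and } t>0,$$ where $$\gamma=\frac{|\alpha-\beta|\,(1-|\alpha|)\,(1-|\beta|)}{|\alpha|+|\beta|-2|\alpha||\beta|}.$$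
   Context: Distribution functions: $\Delta^+$ is the set of all mappings $F\colon\mathbb{R}\cup\{+\infty,-\infty\}\to[0,1]$ that are left continuous and non-decreasing (left continuity is understood at the points of $\mathbb{R}$) with $F(0)=0$ and $F(+\infty)=1$. $D^+$ is the subset of those $F\in\Delta^+$ with $\lim_{t\to+\infty}F(t)=1$. The order is pointwise: $F\le G$ iff $F(t)\le G(t)$ for all $t\in\mathbb{R}$. The function $\varepsilon_0\in\Delta^+$ is given by $\varepsilon_0(t)=0$ for $t\le 0$ and $\varepsilon_0(t)=1$ for $t>0$. A triangular norm ($t$-norm) is a mapping $T\colon[0,1]\times[0,1]\to[0,1]$ that is commutative and associative, satisfies $T(a,1)=a$ for all $a\in[0,1]$, and satisfies $T(a,b)\le T(c,d)$ whenever $a\le c$ and $b\le d$. The minimum $t$-norm is $T_M(a,b)=\min(a,b)$. A random normed space (RN-space) is a triple $(X,\mu,T)$ where $X$ is a (real) vector space, $T$ is a $t$-norm, and $\mu\colon X\to D^+$ is a mapping ($\mu(x)$ is denoted $\mu_x$) such that: (RN1) $\mu_x(t)=\varepsilon_0(t)$ for all $t>0$ if and only if $x=0$; (RN2) $\mu_{\beta x}(t)=\mu_x(t/|\beta|)$ for all $x\in X$ and scalars $\beta\neq0$; (RN3) $\mu_{x+y}(t+s)\ge T(\mu_x(t),\mu_y(s))$ for all $x,y\in X$ and $t,s\ge0$. A sequence $\{x_n\}$ in $X$ converges to $x\in X$ if for every $\varepsilon>0$ and $\lambda>0$ there is a positive integer $N$ such that $\mu_{x_n-x}(\varepsilon)>1-\lambda$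 whenever $n\ge N$. It is a Cauchy sequence if for every $\varepsilon>0$ and $\lambda>0$ there is a positive integer $N$ such that $\mu_{x_n-x_m}(\varepsilon)>1-\lambda$ whenever $n\ge m\ge N$. The RN-space is complete if every Cauchy sequence in $X$ converges to a point of $X$. *)

(* Defs.v *)
From HB Require Import structures.
From mathcomp Require Import all_boot all_order all_algebra.
From mathcomp Require Import all_classical all_reals all_analysis.
Set Implicit Arguments.
Unset Strict Implicit.
Unset Printing Implicit Defensive.
Import Order.TTheory GRing.Theory Num.Theory.
Import numFieldNormedType.Exports.
Local Open Scope classical_set_scope.
Local Open Scope ring_scope.

Record Deltaplus (R : realType) := MkDeltaplus {
  df_fun :> \bar R -> R ;
  df_itv : forall t : \bar R, 0 <= df_fun t <= 1 ;
  df_left_continuous : forall a : R,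
    df_fun x%:E @[x --> a^'-] --> df_fun a%:E ;
  df_nondecreasing : forall s t : \bar R, (s <= t)%E -> df_fun s <= df_fun t ;
  df_0 : df_fun 0%:E = 0 ;
  df_pinfty : df_fun +oo%E = 1 }.

Record Dplus (R : realType) := MkDplus {
  dp_df :> Deltaplus R ;
  dp_lim : dp_df t%:E @[t --> +oo] --> (1 : R) }.

(* The order of distribution functions only compares them at real points. *)
Definition df_le (R : realType) (F G : Deltaplus R) : Prop :=
  forall t : R, F t%:E <= G t%:E.

Definition eps0_fun (R : realType) (t : \bar R) : R :=
  if (0%:E < t)%E then 1 else 0.

Section eps0.
Variable R : realType.

Lemma eps0_itv (t : \bar R) : 0 <= eps0_fun t <= 1.
Proof. by rewrite /eps0_fun; case: ifP => _; rewrite ?lexx ?ler01. Qed.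

Lemma eps0_left_continuous (a : R) :
  eps0_fun x%:E @[x --> a^'-] --> eps0_fun a%:E.
Proof.
rewrite [X in _ --> X]/eps0_fun lte_fin; case: ltP => a0.
- apply: cvg_near_cst; near=> x.
  have x0 : 0 < x by near: x; exact: nbhs_left_gt.
  by rewrite /eps0_fun lte_fin x0.
- apply: cvg_near_cst; near=> x.
  have xa : x <= a by near: x; exact: nbhs_left_le.
  by rewrite /eps0_fun lte_fin ltNge (le_trans xa a0).
Unshelve. all: by end_near. Qed.

Lemma eps0_nondecreasing (s t : \bar R) :
  (s <= t)%E -> eps0_fun s <= eps0_fun t.
Proof.
move=> st; rewrite /eps0_fun; case: ifP => s0; last by case: ifP => _.
by rewrite (lt_le_trans s0 st).
Qed.

Lemma eps0_0 : eps0_fun (0 : R)%:E = 0.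
Proof. by rewrite /eps0_fun ltxx. Qed.

Lemma eps0_pinfty : eps0_fun (+oo%E : \bar R) = 1.
Proof. by rewrite /eps0_fun ltry. Qed.

End eps0.

Definition eps0 (R : realType) : Deltaplus R :=
  MkDeltaplus (@eps0_itv R) (@eps0_left_continuous R)
    (@eps0_nondecreasing R) (@eps0_0 R) (@eps0_pinfty R).

(* A t-norm is a map on [0, 1]; it is represented by a function on R of which
   only the values on [0, 1] x [0, 1] are constrained. *)
Record is_tnorm (R : realType) (T : R -> R -> R) : Prop := {
  tnorm_itv : forall a b, 0 <= a <= 1 -> 0 <= b <= 1 -> 0 <= T a b <= 1 ;
  tnormC : forall a b, 0 <= a <= 1 -> 0 <= b <= 1 -> T a b = T b a ;
  tnormA : forall a b c, 0 <= a <= 1 -> 0 <= b <= 1 -> 0 <= c <= 1 ->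
    T a (T b c) = T (T a b) c ;
  tnorm1 : forall a, 0 <= a <= 1 -> T a 1 = a ;
  tnorm_le : forall a b c d, 0 <= a <= 1 -> 0 <= b <= 1 ->
    0 <= c <= 1 -> 0 <= d <= 1 -> a <= c -> b <= d -> T a b <= T c d }.

Definition TM (R : realType) (a b : R) : R := Num.min a b.

Record is_RN_space (R : realType) (X : lmodType R) (mu : X -> Dplus R)
    (T : R -> R -> R) : Prop := {
  RN_tnorm : is_tnorm T ;
  RN1 : forall x : X,
    (forall t : R, 0 < t -> mu x t%:E = eps0 R t%:E) <-> x = 0 ;
  RN2 : forall (x : X) (b t : R), b != 0 ->
    mu (b *: x) t%:E = mu x (t / `|b|)%:E ;
  RN3 : forall (x y : X) (t s : R), 0 <= t -> 0 <= s ->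
    mu (x + y) (t + s)%:E >= T (mu x t%:E) (mu y s%:E) }.

Definition RN_cvg (R : realType) (X : lmodType R) (mu : X -> Dplus R)
    (u : nat -> X) (x : X) : Prop :=
  forall eps lam : R, 0 < eps -> 0 < lam ->
  exists N : nat, forall n : nat, (N <= n)%N ->
    mu (u n - x) eps%:E > 1 - lam.

Definition RN_cauchy (R : realType) (X : lmodType R) (mu : X -> Dplus R)
    (u : nat -> X) : Prop :=
  forall eps lam : R, 0 < eps -> 0 < lam ->
  exists N : nat, forall n m : nat, (N <= m)%N -> (m <= n)%N ->
    mu (u n - u m) eps%:E > 1 - lam.

Definition RN_complete (R : realType) (X : lmodType R) (mu : X -> Dplus R) :
    Prop :=
  forall u : nat -> X, RN_cauchy mu u -> exists x : X, RN_cvg mu u x.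

(* Main.v *)
Require Import Defs.
From HB Require Import structures.
From mathcomp Require Import all_boot all_order all_algebra.
From mathcomp Require Import all_classical all_reals all_analysis.
From mathcomp Require Import ring.
Set Implicit Arguments.
Unset Strict Implicit.
Unset Printing Implicit Defensive.
Import Order.TTheory GRing.Theory Num.Theory.
Import numFieldNormedType.Exports.
Local Open Scope classical_set_scope.
Local Open Scope ring_scope.

(** Since [alpha] and [beta] are the roots of [x^2 - p x + q], the second-order
    difference operator factors: with [S f x = f (x - 1)],
      [1 - p S + q S^2 = (1 - beta S)(1 - alpha S) = (1 - alpha S)(1 - beta S)].
    Hence both [f - alpha S f] and [f - beta S f] are approximate solutions,
    with error [phi], of a first-order equation [h = c S h], for [c = beta] and
    [c = alpha] respectively.

    First-order equations with [0 < |c| < 1] are stable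
    ([first_order_stability]): [c^n h(x - n)] is a Cauchy sequence whose limit
    [G x] solves [G = c S G] exactly, and [h - G] is controlled by
    [phi_x ((1 - |c|) t)].  This rests on the estimate [iterate_estimate]; the
    minimum t-norm is what makes it uniform in [n], because combining
    arbitrarily many terms bounded below by [phi_x] again gives [phi_x].

    Finally [f] is recovered from its two first-order differences,
      [(alpha - beta) f = alpha (f - beta S f) - beta (f - alpha S f)],
    and the same combination of the two exact first-order solutions is [F].
    The constant [gamma] is the one for which the two errors, at the arguments
    where each of them is bounded below by [phi_x (gamma t)], add up to [t]. *)

(** * Random norms for the minimum t-norm *)

Section RandomNorm.
Variables (R : realType) (X : lmodType R) (mu : X -> Dplus R).
Hypothesis hRN : is_RN_space mu (@TM R).

Lemma df_le1 (D : Deltaplus R) (t : \bar R) : D t <= 1.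
Proof. by case/andP: (df_itv D t). Qed.

Lemma df_homo (D : Deltaplus R) (s t : R) : s <= t -> D s%:E <= D t%:E.
Proof. by move=> st; apply: df_nondecreasing; rewrite lee_fin. Qed.

(** Passing to a limit in a random norm costs an arbitrarily small part of the
    argument; left continuity is what recovers the endpoint. *)
Lemma df_le_left (D : Deltaplus R) (a b : R) :
  (forall s, s < a -> D s%:E <= b) -> D a%:E <= b.
Proof.
move=> H; rewrite leNgt; apply/negP => lt_b.
have Hnear := cvgr_gt (D a%:E) (@df_left_continuous _ D a) _ lt_b.
have [s [sa bs]] : exists s, s < a /\ b < D s%:E.
  near (a^'-) => s; exists s; split; near: s; last exact: Hnear.
  exact: nbhs_left_lt.
by move: (H s sa); rewrite leNgt bs.
Unshelve. all: by end_near. Qed.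

Lemma RN_zero (t : R) : 0 < t -> mu 0 t%:E = 1.
Proof.
move=> t0; have [_ H] := RN1 hRN 0.
by rewrite (H erefl t t0) /= /eps0_fun lte_fin t0.
Qed.

Lemma RN_scale (x : X) (b t : R) :
  b != 0 -> mu (b *: x) (`|b| * t)%:E = mu x t%:E.
Proof.
by move=> b0; rewrite (RN2 hRN) // mulrAC divff ?mul1r ?normr_eq0.
Qed.

Lemma RN_opp (x : X) (t : R) : mu (- x) t%:E = mu x t%:E.
Proof.
have := @RN_scale x (-1) t; rewrite scaleN1r normrN1 mul1r; apply.
by rewrite oppr_eq0 oner_neq0.
Qed.

Lemma RN_add_ge (x y : X) (s t a : R) : 0 <= s -> 0 <= t ->
  a <= mu x s%:E -> a <= mu y t%:E -> a <= mu (x + y) (s + t)%:E.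
Proof.
move=> s0 t0 ax ay; apply: le_trans (RN3 hRN x y s0 t0).
by rewrite /TM le_min ax ay.
Qed.

(** The slack [t - s] in the argument absorbs the distance from [u n] to the
    limit. *)
Lemma RN_cvg_ge (u : nat -> X) (l y : X) (s t a : R) : RN_cvg mu u l ->
  0 <= s -> s < t -> a <= 1 -> (forall n, a <= mu (y - u n) s%:E) ->
  a <= mu (y - l) t%:E.
Proof.
move=> ul s0 st a1 Ha; apply/ler_addgt0Pr => e e0.
have ts : 0 < t - s by rewrite subr_gt0.
have [N HN] := ul (t - s) e ts e0.
have /ltW {}HN := HN N (leqnn N).
rewrite -lerBlDr.
have -> : y - l = (y - u N) + (u N - l) by rewrite addrA subrK.
have -> : t = s + (t - s) by rewrite addrC subrK.
apply: RN_add_ge => //; first exact: ltW.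
  by apply: le_trans (Ha N); rewrite gerBl ltW.
by apply: le_trans HN; rewrite lerD2r.
Qed.

Lemma RN_cvg_unique (u : nat -> X) (l l' : X) :
  RN_cvg mu u l -> RN_cvg mu u l' -> l = l'.
Proof.
move=> ul ul'; apply/eqP; rewrite -subr_eq0; apply/eqP/(RN1 hRN) => t t0.
rewrite /= /eps0_fun lte_fin t0; apply: le_anti; rewrite df_le1 /=.
apply/ler_addgt0Pr => e e0; rewrite -lerBlDr.
have t2 : 0 < t / 2 by rewrite divr_gt0.
have [N HN] := ul _ _ t2 e0; have [M HM] := ul' _ _ t2 e0.
pose k := maxn N M.
have -> : l - l' = - (u k - l) + (u k - l') by rewrite opprB addrA subrK.
rewrite [t]splitr; apply: RN_add_ge; rewrite ?RN_opp ?(ltW t2) //.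
  by apply/ltW/HN; rewrite leq_maxl.
by apply/ltW/HM; rewrite leq_maxr.
Qed.

Lemma RN_cvg_scale (u : nat -> X) (l : X) (c : R) : c != 0 ->
  RN_cvg mu u l -> RN_cvg mu (fun n => c *: u n) (c *: l).
Proof.
move=> c0 ul e lam e0 lam0.
have c0' : 0 < `|c| by rewrite normr_gt0.
have [N HN] := ul _ _ (divr_gt0 e0 c0') lam0.
by exists N => n /HN; rewrite -scalerBr (RN2 hRN).
Qed.

Lemma RN_cvg_shift (u : nat -> X) (l : X) :
  RN_cvg mu u l -> RN_cvg mu (fun n => u n.+1) l.
Proof.
move=> ul e lam e0 lam0; have [N HN] := ul _ _ e0 lam0.
by exists N => n Nn; apply: HN; rewrite (leq_trans Nn).
Qed.

(** * Stability of the first-order equation *)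

Section FirstOrder.
Variables (c : R) (phi : R -> Dplus R) (h : R -> X).
Hypotheses (c_neq0 : c != 0) (c_lt1 : `|c| < 1).
Hypothesis phi_lim :
  forall t : R, 0 < t -> phi x t%:E @[x --> -oo] --> (1 : R).
Hypothesis phi_le : forall x : R, df_le (phi (x + 1)) (phi x).
Hypothesis h_approx : forall x : R, df_le (phi x) (mu (h x - c *: h (x - 1))).

Let c_compl : 0 < 1 - `|c|. Proof. by rewrite subr_gt0. Qed.

(** Induction on [n] from
      [h x - c^(n+1) h(x-n-1) = (h x - c h(x-1)) + c (h(x-1) - c^n h(x-1-n))],
    splitting the argument as [s = (1 - |c|) s + |c| s].  The induction
    hypothesis at [x - 1] gives back the very same bound, as [phi] only
    improves to the left. *)
Lemma iterate_estimate (n : nat) (x s : R) : 0 < s ->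
  phi x ((1 - `|c|) * s)%:E <= mu (h x - c ^+ n *: h (x - n%:R)) s%:E.
Proof.
elim: n x => [|n IHn] x s0.
  by rewrite expr0 scale1r subr0 subrr RN_zero // df_le1.
have -> : h x - c ^+ n.+1 *: h (x - n.+1%:R) =
    (h x - c *: h (x - 1)) + c *: (h (x - 1) - c ^+ n *: h (x - 1 - n%:R)).
  rewrite scalerBr addrA subrK scalerA -exprS.
  by rewrite -[n.+1]add1n natrD opprD addrA.
have split_s : s = (1 - `|c|) * s + `|c| * s by ring.
rewrite [X in mu _ X%:E]split_s.
apply: RN_add_ge; rewrite ?mulr_ge0 ?(ltW s0) ?(ltW c_compl) //.
  exact: h_approx.
rewrite RN_scale //; apply: le_trans (IHn _ s0).
by have := @phi_le (x - 1) ((1 - `|c|) * s); rewrite subrK.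
Qed.

(** The distance between the [m]-th and the [n]-th iterate is [|c|^m] times an
    instance of [iterate_estimate] at the point [x - m], where [phi] is close
    to [1]. *)
Lemma iterate_cauchy (x : R) :
  RN_cauchy mu (fun n => c ^+ n *: h (x - n%:R)).
Proof.
move=> e lam e0 lam0.
have e1 : 0 < (1 - `|c|) * e by rewrite mulr_gt0.
have lam1 : 1 - lam < 1 by rewrite gtrBl.
have [M [_ HM]] := cvgr_gt 1 (phi_lim e1) _ lam1.
have [N HN] : exists N : nat, forall m : nat, (N <= m)%N -> x - m%:R < M.
  exists (Num.trunc `|x - M|).+1 => m Nm.
  have Nx : `|x - M| < m%:R.
    by apply: lt_le_trans (truncnS_gt _) _; rewrite ler_nat.
  by rewrite ltrBlDr -ltrBlDl; apply: le_lt_trans (ler_norm _) Nx.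
exists N => n m Nm mn; apply: lt_le_trans (HM _ (HN _ Nm)) _.
have -> : c ^+ n *: h (x - n%:R) - c ^+ m *: h (x - m%:R) =
    - (c ^+ m *: (h (x - m%:R) - c ^+ (n - m) *: h (x - m%:R - (n - m)%:R))).
  rewrite scalerBr scalerA -exprD subnKC // opprB.
  by rewrite -addrA -opprD -natrD subnKC.
rewrite RN_opp.
have cm0 : c ^+ m != 0 by rewrite expf_neq0.
apply: le_trans (iterate_estimate (n - m) (x - m%:R) e0) _.
rewrite -(RN_scale _ _ cm0); apply: df_homo.
by rewrite normrX ler_piMl ?(ltW e0) // exprn_ile1 // ltW.
Qed.

Hypothesis mu_complete : RN_complete mu.

(** Shifting the sequence of iterates by one multiplies it by [c] and moves [x]
    to [x - 1], so uniqueness of limits makes the limit an exact solution. *)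
Lemma first_order_stability : exists G : R -> X,
  (forall x, G x = c *: G (x - 1)) /\
  (forall x t : R, 0 < t ->
    phi x ((1 - `|c|) * t)%:E <= mu (h x - G x) t%:E).
Proof.
have /choice [G HG] : forall x, exists l,
    RN_cvg mu (fun n => c ^+ n *: h (x - n%:R)) l.
  by move=> x; apply/mu_complete/iterate_cauchy.
exists G; split=> [x|x t t0].
  apply: RN_cvg_unique (RN_cvg_shift (HG x)) _.
  have -> : (fun n => c ^+ n.+1 *: h (x - n.+1%:R)) =
      (fun n => c *: (c ^+ n *: h (x - 1 - n%:R))).
    apply/funext => n; rewrite scalerA -exprS.
    by rewrite -[n.+1 in LHS]add1n natrD opprD addrA.
  exact: RN_cvg_scale.
apply: df_le_left => s'; rewrite mulrC -ltr_pdivrMr // => s't.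
(* The limit lemma needs a positive argument, while [s'] is arbitrary. *)
pose s := Num.max (s' / (1 - `|c|)) (t / 2).
have s0 : 0 < s by rewrite lt_max [X in _ || X]divr_gt0 ?orbT.
have st : s < t by rewrite gt_max s't /= gtr_pMr // invf_lt1 // ltr1n.
apply: RN_cvg_ge (HG x) (ltW s0) st _ _; first exact: df_le1.
move=> n; apply: le_trans (iterate_estimate n x s0).
by apply: df_homo; rewrite mulrC -ler_pdivrMr // le_max lexx.
Qed.

End FirstOrder.

End RandomNorm.

(** * The second-order equation *)

(** This is [1 - (a + b) S + a b S^2 = (1 - b S)(1 - a S)], with [S] the shift
    by [1]. *)
Lemma second_difference_factor (R : realType) (X : lmodType R) (f : R -> X)
    (a b x : R) :
  f x - (a + b) *: f (x - 1) + (a * b) *: f (x - 2) =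
  (f x - a *: f (x - 1)) - b *: (f (x - 1) - a *: f (x - 1 - 1)).
Proof.
have -> : x - 1 - 1 = x - 2 by ring.
rewrite scalerBr scalerA scalerDl opprD opprB addrA (mulrC a b).
by rewrite -!addrA (addrC (- (b *: _))).
Qed.

Theorem theorem2p1 (R : realType) (p q alpha beta : R)
    (halpha : alpha ^+ 2 - p * alpha + q = 0)
    (hbeta : beta ^+ 2 - p * beta + q = 0)
    (hneq : alpha != beta)
    (hbeta0 : 0 < `|beta|) (hba : `|beta| < `|alpha|) (halpha1 : `|alpha| < 1)
    (phi : R -> Dplus R)
    (hphi_lim : forall t : R, 0 < t -> phi x t%:E @[x --> -oo] --> (1 : R))
    (hphi_le : forall x : R, df_le (phi (x + 1)) (phi x))
    (X : lmodType R) (mu : X -> Dplus R)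
    (hRN : is_RN_space mu (@TM R)) (hcomplete : RN_complete mu)
    (f : R -> X)
    (hf : forall x : R,
      df_le (phi x) (mu (f x - p *: f (x - 1) + q *: f (x - 2)))) :
  exists F : R -> X,
    (forall x : R, F x = p *: F (x - 1) - q *: F (x - 2)) /\
    (forall x t : R, 0 < t ->
      phi x ((`|alpha - beta| * (1 - `|alpha|) * (1 - `|beta|)
              / (`|alpha| + `|beta| - 2 * `|alpha| * `|beta|)) * t)%:E
      <= mu (f x - F x) t%:E).

Proof.
have ab0 : alpha - beta != 0 by rewrite subr_eq0.
have Ep : p = alpha + beta.
  apply: (mulfI ab0); apply/eqP; rewrite -subr_eq0; apply/eqP.
  transitivity ((beta ^+ 2 - p * beta + q) - (alpha ^+ 2 - p * alpha + q)).
    by ring.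
  by rewrite halpha hbeta subrr.
have Eq : q = alpha * beta.
  apply/eqP; rewrite -subr_eq0; apply/eqP; rewrite -[RHS]halpha Ep; ring.
have beta0 : beta != 0 by rewrite -normr_gt0.
have alpha0 : alpha != 0 by rewrite -normr_gt0 (lt_trans hbeta0).
have hbeta1 : `|beta| < 1 by apply: lt_trans halpha1.
have [Gb [Gb_rec Gb_near]] := first_order_stability hRN (c := beta)
  (h := fun x => f x - alpha *: f (x - 1)) beta0 hbeta1 hphi_lim hphi_le
  ltac:(by move=> x; rewrite -second_difference_factor -Ep -Eq; apply: hf)
  hcomplete.
have [Ga [Ga_rec Ga_near]] := first_order_stability hRN (c := alpha)
  (h := fun x => f x - beta *: f (x - 1)) alpha0 halpha1 hphi_lim hphi_le
  ltac:(by move=> x; rewrite -second_difference_factor (addrC beta)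
    (mulrC beta) -Ep -Eq; apply: hf)
  hcomplete.
(* The coefficients recovering [f] from its two first-order differences. *)
pose A := alpha / (alpha - beta); pose B := - (beta / (alpha - beta)).
exists (fun x => A *: Ga x + B *: Gb x); split=> [x|x t t0].
  rewrite (Ga_rec x) (Gb_rec x) (Ga_rec (x - 1)) (Gb_rec (x - 1)).
  have -> : x - 1 - 1 = x - 2 by ring.
  set y := x - 2; rewrite !scalerDr !scalerA opprD addrACA -!scalerBl.
  by congr (_ *: _ + _ *: _); rewrite Ep Eq; ring.
have -> : f x - (A *: Ga x + B *: Gb x) =
    A *: (f x - beta *: f (x - 1) - Ga x) +
    B *: (f x - alpha *: f (x - 1) - Gb x).
  rewrite !scalerBr !scalerA opprD !addrA.
  rewrite [RHS](AC 6 ((1*4)*(2*5)*3*6))%AC/= -scalerDl -opprD -scalerDl.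
  have -> : A + B = 1 by rewrite /A /B; field.
  have -> : A * beta + B * alpha = 0 by rewrite /A /B; ring.
  by rewrite scale1r scale0r subr0.
set gamma := (X in X * t).
have na0 : 0 < `|alpha| by rewrite normr_gt0.
have a1 : 0 < 1 - `|alpha| by rewrite subr_gt0.
have b1 : 0 < 1 - `|beta| by rewrite subr_gt0.
have nab0 : 0 < `|alpha - beta| by rewrite normr_gt0.
have den0 : 0 < `|alpha| + `|beta| - 2 * `|alpha| * `|beta|.
  have -> : `|alpha| + `|beta| - 2 * `|alpha| * `|beta| =
    `|alpha| * (1 - `|beta|) + `|beta| * (1 - `|alpha|) by ring.
  by rewrite addr_gt0 // mulr_gt0.
have gt0 : 0 < gamma * t by rewrite mulr_gt0 // divr_gt0 // !mulr_gt0.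
have nA : `|A| = `|alpha| / `|alpha - beta| by rewrite normrM normfV.
have nB : `|B| = `|beta| / `|alpha - beta| by rewrite normrN normrM normfV.
have A0 : A != 0 by rewrite mulf_neq0 // invr_eq0.
have B0 : B != 0 by rewrite oppr_eq0 mulf_neq0 // invr_eq0.
(* The arguments at which the two first-order bounds become [phi x (gamma t)];
   that they add up to [t] determines [gamma]. *)
have split_t : t = `|A| * (gamma * t / (1 - `|alpha|)) +
                    `|B| * (gamma * t / (1 - `|beta|)).
  by rewrite nA nB /gamma; field; rewrite ?lt0r_neq0.
rewrite [X in _ <= mu _ X%:E]split_t.
have ta0 : 0 < gamma * t / (1 - `|alpha|) by rewrite divr_gt0.
have tb0 : 0 < gamma * t / (1 - `|beta|) by rewrite divr_gt0.
apply: (RN_add_ge hRN).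
- exact: mulr_ge0 (normr_ge0 _) (ltW ta0).
- exact: mulr_ge0 (normr_ge0 _) (ltW tb0).
- rewrite (RN_scale hRN) //; apply: le_trans (Ga_near x _ ta0).
  by rewrite (mulrC _ (_ / _)) divfK // lt0r_neq0.
- rewrite (RN_scale hRN) //; apply: le_trans (Gb_near x _ tb0).
  by rewrite (mulrC _ (_ / _)) divfK // lt0r_neq0.
Qed.
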